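(* Let $S=\{g_1,\dots,g_s\}\subset\mathbb{R}[X]$ be a finite set of polynomials such that $K_S$ is compact, and let $g_{s+1}\in\mathbb{R}[X]$ be a polynomial. If $S$ is Putinar, then $S':=S\cup\{g_{s+1}\}$ is Putinar.
   Context: $\mathbb{R}[X]:=\mathbb{R}[x_1,\dots,x_n]$, and $\sum\mathbb{R}[X]^2$ is the set of finite sums of squares of polynomials. For a finite set $S=\{g_1,\dots,g_s\}\subset\mathbb{R}[X]$: $K_S:=\{x\in\mathbb{R}^n\mid g_i(x)\ge 0,\ i=1,\dots,s\}$ and $M_S:=\{\sum_{i=0}^{s}\sigma_i g_i\mid \sigma_i\in\sum\mathbb{R}[X]^2,\ g_0:=1\}$ (the quadratic module defined by $S$). The set $S$ is called Putinar if every polynomial in $\mathbb{R}[X]$ which is strictly positive at every point of $K_S$ belongs to $M_S$. *)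

(* Defs.v *)
From HB Require Import structures.
From mathcomp Require Import all_boot all_order all_algebra finmap.
From mathcomp Require Import boolp classical_sets reals topology normedtype.
From mathcomp Require Import -(notations) mpoly.

Set Implicit Arguments.
Unset Strict Implicit.
Unset Printing Implicit Defensive.

Import Order.TTheory GRing.Theory Num.Theory.
Import numFieldNormedType.Exports.

Local Open Scope classical_set_scope.
Local Open Scope ring_scope.

(* The notations of mpoly clash with those of mathcomp-analysis. *)
Notation rpoly R n := (mpoly n R).

Definition evalp (R : realType) (n : nat) (p : rpoly R n) (x : 'rV[R]_n) : R :=
  meval (fun i => x ord0 i) p.

Definition sos (R : realType) (n : nat) : set (rpoly R n) :=
  [set p | exists r : seq (rpoly R n), p = \sum_(q <- r) q ^+ 2].

Definition basic_closed (R : realType) (n : nat) (S : {fset rpoly R n}) : set 'rV[R]_n :=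
  [set x | forall g, g \in S -> 0 <= evalp g x].

(* sigma0 is the multiplier of g_0 := 1, which need not belong to S. *)
Definition quadratic_module (R : realType) (n : nat) (S : {fset rpoly R n}) : set (rpoly R n) :=
  [set p | exists (sigma0 : rpoly R n) (sigma : rpoly R n -> rpoly R n),
     [/\ sos sigma0,
         forall g, g \in S -> sos (sigma g) &
         p = sigma0 + \sum_(g <- S) sigma g * g]].

Definition putinar (R : realType) (n : nat) (S : {fset rpoly R n}) : Prop :=
  forall p : rpoly R n, (forall x, basic_closed S x -> 0 < evalp p x) -> quadratic_module S p.

(* Main.v *)
Require Import Defs.
From HB Require Import structures.
From mathcomp Require Import all_boot all_order all_algebra finmap.
From mathcomp Require Import boolp classical_sets reals topology normedtype.
From mathcomp Require Import -(notations) mpoly.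
From mathcomp Require Import realfun lra.

(** Let [f] be positive on the points of [K_S] where [g >= 0].  It suffices to
    find a sum of squares [s] with [f - s g > 0] on all of [K_S]: since [S] is
    Putinar, [f - s g] then lies in the quadratic module of [S], and adding
    back [s g] puts [f] in that of [g |` S] ([quadratic_module_fsetU1]; there
    is nothing to prove when [g] already belongs to [S]).

    The multiplier is explicit, so no approximation theorem is involved.  As
    [K_S] is compact, [g] can be scaled to satisfy [g <= 1] there.  Take
    [s = c (1 - g)^m] with [m] even.  Where [g <= 0] one has [(1 - g)^m >= 1],
    so [f - s g >= f - c g], which is positive for [c] large: by compactness
    [- g] is bounded away from [0] where [f <= 0].  Where [g >= 0] the
    correction [s g] is at most [c / m] ([mul_expr_onem_le1]), which for [m]
    large is less than the minimum of [f] there.  The constant [c] is fixed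
    before [m], and this is what makes the two requirements compatible
    ([damped_multiplier]). *)

Set Implicit Arguments.
Unset Strict Implicit.
Unset Printing Implicit Defensive.

Import Order.TTheory GRing.Theory Num.Theory.
Import numFieldNormedType.Exports.

Local Open Scope classical_set_scope.
Local Open Scope ring_scope.

(** The left-hand side does not increase with [m], because
    [(1 - t) * (1 + (m + 1) * t) <= 1 + m * t]. *)
Lemma expr_onem_bernoulli (R : realDomainType) (t : R) m :
  0 <= t <= 1 -> (1 - t) ^+ m * (1 + m%:R * t) <= 1.
Proof.
move=> /andP[t0 t1]; elim: m => [|m IH]; first by rewrite expr0 mul0r addr0 mulr1.
apply: le_trans IH; rewrite exprSr -mulrA; apply: ler_wpM2l.
  by rewrite exprn_ge0 // subr_ge0.
have m0 : 0 <= m%:R :> R by [].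
by rewrite -natr1; nra.
Qed.

(** Near [0] the factor [t] is small, and away from [0] the power is. *)
Lemma mul_expr_onem_le1 (R : realDomainType) (t : R) m :
  0 <= t <= 1 -> m%:R * ((1 - t) ^+ m * t) <= 1.
Proof.
move=> t01; apply: le_trans (expr_onem_bernoulli m t01).
have /andP[t0 t1] := t01.
have p0 : 0 <= (1 - t) ^+ m by rewrite exprn_ge0 // subr_ge0.
by rewrite mulrCA mulrDr mulr1 lerDr.
Qed.

Section CompactBounds.
Context (R : realType) (T : topologicalType) (K : set T) (u : T -> R).
Hypotheses (Kcompact : compact K) (ucont : continuous u).

Let uKcompact : compact (u @` K).
Proof. by apply: continuous_compact => //; exact: continuous_subspaceT. Qed.

Lemma compact_continuous_ub : exists2 M, 0 < M & forall x, K x -> u x <= M.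
Proof.
have [M [_ MuK]] := compact_bounded uKcompact.
exists (`|M| + 1) => [|x Kx]; first by rewrite ltr_wpDl.
apply: le_trans (ler_norm _) _; apply: MuK; last by exists x.
by rewrite (le_lt_trans (ler_norm M)) // ltrDl.
Qed.

(** The image of [K] is closed and misses [0], hence misses a neighbourhood of
    [0]; this also covers an empty [K]. *)
Lemma compact_continuous_pos_lb :
  (forall x, K x -> 0 < u x) -> exists2 e, 0 < e & forall x, K x -> e <= u x.
Proof.
move=> u_gt0; have uKclosed := compact_closed (@Rhausdorff R) uKcompact.
have /nbhs_ballP[e /= e0 eK] : nbhs (0 : R) (~` (u @` K)).
  apply: open_nbhs_nbhs; split; first exact: closed_openC.
  by move=> [x Kx ux0]; have := u_gt0 x Kx; rewrite ux0 ltxx.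
exists e => // x Kx; rewrite leNgt; apply/negP => uxe.
apply: (eK (u x)); last by exists x.
by rewrite /ball /= sub0r normrN gtr0_norm // u_gt0.
Qed.

End CompactBounds.

(** The power damps [g] where it is positive and amplifies it where it is
    negative; both push [f - s * g] up compared with a constant multiplier [s].
    The power is squared so that the multiplier of [g] becomes a sum of squares when [f] and
    [g] are polynomials. *)
Lemma damped_multiplier (R : realType) (T : topologicalType) (K : set T)
    (f g : T -> R) :
  compact K -> continuous f -> continuous g ->
  (forall x, K x -> 0 <= g x -> 0 < f x) ->
  exists a b : R, exists m, 0 <= a /\
    forall x, K x -> 0 < f x - a * ((1 - b * g x) ^+ m) ^+ 2 * g x.
Proof.
move=> Kc fc gc fg.
have gNc : continuous (fun x => - g x) by move=> x; apply: cvgN; exact: gc.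
have fNc : continuous (fun x => - f x) by move=> x; apply: cvgN; exact: fc.
have [M M0 gM] := compact_continuous_ub Kc gc.
have [B B0 fB] := compact_continuous_ub Kc fNc.
have Kg : compact (K `&` [set x | 0 <= g x]).
  apply: compact_closedI => //.
  exact: (@preimage_closed _ _ g [set y | 0 <= y] (fun x _ => gc x) (@closed_ge R 0)).
have Kf : compact (K `&` [set x | f x <= 0]).
  apply: compact_closedI => //.
  exact: (@preimage_closed _ _ f [set y | y <= 0] (fun x _ => fc x) (@closed_le R 0)).
have [e e0 fe] : exists2 e, 0 < e & forall x, K x -> 0 <= g x -> e <= f x.
  have [x [Kx gx]|e e0 he] := compact_continuous_pos_lb Kg fc; first exact: fg.
  by exists e => // x Kx gx; exact: he.
have [d d0 gd] : exists2 d, 0 < d & forall x, K x -> f x <= 0 -> d <= - g x.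
  have [x [Kx fx]|d d0 hd] := compact_continuous_pos_lb Kf gNc.
    by rewrite oppr_gt0 ltNge; apply/negP => /(fg _ Kx); rewrite ltNge fx.
  by exists d => // x Kx fx; exact: hd.
(* - f <= B and - g >= d where f <= 0, so this a gives f - a g >= d > 0 there *)
pose a := B / d + 1.
have a0 : 0 < a by rewrite addr_gt0 // divr_gt0.
have ad : a * d = B + d by rewrite mulrDl mul1r divfK // gt_eqF.
(* Where g >= 0, t = g / M satisfies m t (1 - t)^(2m) <= 1, so the correction
   a g (1 - t)^(2m) is at most a M / m < e. *)
pose m := (Num.truncn (a * M / e)).+1.
have hm : a * M < e * m%:R.
  by rewrite [e * _]mulrC -ltr_pdivrMr // truncnS_gt.
exists a, M^-1, m; split=> [|x Kx]; first exact: ltW.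
have [t tE] : exists t, t = M^-1 * g x by exists (M^-1 * g x).
rewrite -tE.
have gt : g x = M * t by rewrite tE mulrA divff ?mul1r // gt_eqF.
have t1 : t <= 1 by rewrite tE mulrC ler_pdivrMr // mul1r gM.
rewrite -exprM -mulrA; have [g0|g0] := leP 0 (g x).
  have t0 : 0 <= t by rewrite tE mulr_ge0 // invr_ge0 ltW.
  have t01 : 0 <= t <= 1 by rewrite t0.
  have pt_le1 := mul_expr_onem_le1 (m * 2) t01.
  have pt_ge0 : 0 <= (1 - t) ^+ (m * 2) * t.
    by rewrite mulr_ge0 // exprn_ge0 // subr_ge0.
  rewrite gt subr_gt0; apply: lt_le_trans (fe x Kx g0).
  rewrite [_ ^+ _ * (M * t)]mulrCA [a * _]mulrA.
  move: pt_ge0 pt_le1; rewrite natrM; move: (_ * t) => q q0 mq1.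
  have [->|qn0] := eqVneq q 0; first by rewrite mulr0.
  have q_gt0 : 0 < q by rewrite lt_def qn0.
  apply: (@lt_le_trans _ _ (e * m%:R * q)); first by rewrite ltr_pM2r.
  have m0 : 0 <= m%:R :> R by [].
  by rewrite -mulrA -[leRHS]mulr1 ler_pM2l //; nra.
have tN : t < 0 by rewrite tE pmulr_rlt0 // invr_gt0.
have p1 : 1 <= (1 - t) ^+ (m * 2) by rewrite exprn_ege1 // lerBrDr gerDl ltW.
have agp : a * ((1 - t) ^+ (m * 2) * g x) <= a * g x.
  by rewrite ler_pM2l // ger_nMl.
have agN : a * g x < 0 by rewrite pmulr_rlt0.
have [fx|fx] := ltP 0 (f x); first by lra.
have : a * d <= a * - g x by rewrite ler_pM2l // gd.
have := fB x Kx; rewrite mulrN ad; lra.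
Qed.

Lemma meval_continuous (R : realType) (T : topologicalType) n
    (v : 'I_n -> T -> R) (p : rpoly R n) :
  (forall i, continuous (v i)) -> continuous (fun x => meval (v ^~ x) p).
Proof.
move=> vc; under eq_fun do rewrite mevalE.
apply: continuous_big => [|m _ x]; first exact: add_continuous.
apply: cvgM; first exact: cvg_cst.
move: x; apply: continuous_big => [|i _ x].
  by move=> z; apply: cvgM; [exact: cvg_fst|exact: cvg_snd].
apply: (@continuous_comp T R R (v i) (fun y => y ^+ m i)); first exact: vc.
exact: exprn_continuous.
Qed.

Lemma evalp_continuous (R : realType) n (p : rpoly R n) : continuous (evalp p).
Proof.
apply: (@meval_continuous R 'rV[R]_n n (fun i x => x ord0 i)) => i.
exact: coord_continuous.
Qed.

(** As [g] is not in [S], the family of multipliers can be given the value [s]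
    at [g] without disturbing the terms indexed by [S]. *)
Lemma quadratic_module_fsetU1 (R : realType) n (S : {fset rpoly R n})
    (g s p : rpoly R n) :
  g \notin S -> sos s -> quadratic_module S (p - s * g) ->
  quadratic_module (g |` S)%fset p.
Proof.
move=> gS sos_s [s0 [sg [sos_s0 sos_sg pE]]].
exists s0, (fun h => if h == g then s else sg h); split=> //.
  by move=> h; rewrite !inE; case: eqP => //= _; exact: sos_sg.
rewrite big_fsetU1 //= eqxx; apply/eqP; rewrite addrCA addrC -subr_eq pE.
apply/eqP; congr (_ + _); apply: eq_big_seq => h hS.
by case: eqP => // hg; rewrite hg (negPf gS) in hS.
Qed.

Theorem proposition3p1 (R : realType) (n : nat) (S : {fset rpoly R n})
  (g : rpoly R n) (Kcompact : compact (basic_closed S)) (Sputinar : putinar S) :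
  putinar (g |` S)%fset.
Proof.
move=> f f_gt0.
have [gS|gS] := boolP (g \in S).
  by move: f_gt0; rewrite (fsetUidPr _ _ _) ?fsub1set //; exact: Sputinar.
have [x Kx gx|a [b [m [a0 fag]]]] := damped_multiplier Kcompact
    (@evalp_continuous R n f) (@evalp_continuous R n g).
  by apply: f_gt0 => h; rewrite !inE => /predU1P[->//|]; exact: Kx.
pose q : rpoly R n := Num.sqrt a *: (1 - b *: g) ^+ m.
apply: (@quadratic_module_fsetU1 _ _ _ _ (q ^+ 2)) => //.
  by exists [:: q]; rewrite big_seq1.
apply: Sputinar => x /fag; congr (0 < _).
by rewrite /evalp mevalB mevalM rmorphXn /= mevalZ rmorphXn /= mevalB meval1 mevalZ
  exprMn sqr_sqrtr.
Qed.
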